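(* Let $m\geq 2$ and $r\geq 3$ be integers. There exists a constant $b_{m,r}>0$, depending only on $m$ and $r$, such that for every positive integer $t$, $$R(C^r_{2m+1},K^r_t)\leq b_{m,r}\, t^{\frac{m}{m-1}}.$$
   Context: An $r$-graph is an $r$-uniform hypergraph. $K^r_t$ is the complete $r$-graph on $t$ vertices. $C^r_{k}$ is the $r$-uniform linear cycle of length $k$: edges $e_1,\ldots,e_k$ with $|e_i\cap e_{i+1}|=1$ for $i\in[k-1]$, $|e_k\cap e_1|=1$, and $e_i\cap e_j=\emptyset$ for all other pairs $i\neq j$. For $r$-graphs $G,H$, the Ramsey number $R(G,H)$ is the smallest positive integer $n$ such that every red/blue coloring of the edges of $K^r_n$ contains a red copy of $G$ or a blue copy of $H$. *)

(* Defs.v *)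
From HB Require Import structures.
From mathcomp Require Import all_boot all_order all_algebra.
From mathcomp Require Import reals exp.

Set Implicit Arguments.
Unset Strict Implicit.
Unset Printing Implicit Defensive.

Record r_graph (r : nat) := RGraph {
  vertex :> finType;
  edges : {set {set vertex}};
  edges_uniform : forall e : {set vertex}, e \in edges -> #|e| = r
}.

Definition contains_copy (r : nat) (H G : r_graph r) : Prop :=
  exists f : G -> H,
    injective f /\ (forall e : {set G}, e \in edges G -> f @: e \in edges H).

Definition complete_edges (r n : nat) : {set {set 'I_n}} :=
  [set e : {set 'I_n} | #|e| == r].

Lemma complete_uniform (r n : nat) (e : {set 'I_n}) :
  e \in complete_edges r n -> #|e| = r.
Proof. by rewrite inE => /eqP. Qed.

Definition complete_r_graph (r n : nat) : r_graph r := RGraph (@complete_uniform r n).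

(* A red/blue coloring of the edges of [complete_r_graph r n] is given by a map
   [c : {set 'I_n} -> bool] (true = red, false = blue); only its values on sets
   of cardinality r are ever used. *)
Definition color_edges (r n : nat) (c : {set 'I_n} -> bool) (b : bool) :
    {set {set 'I_n}} :=
  [set e in complete_edges r n | c e == b].

Lemma color_uniform (r n : nat) (c : {set 'I_n} -> bool) (b : bool)
    (e : {set 'I_n}) :
  e \in color_edges r c b -> #|e| = r.
Proof. by rewrite inE => /andP[/complete_uniform]. Qed.

Definition color_class (r n : nat) (c : {set 'I_n} -> bool) (b : bool) :
    r_graph r :=
  RGraph (@color_uniform r n c b).

Definition ramsey_prop (r : nat) (G H : r_graph r) (n : nat) : Prop :=
  forall c : {set 'I_n} -> bool,
    contains_copy (color_class r c true) G \/
    contains_copy (color_class r c false) H.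

(* [is_ramsey_number G H N] means R(G, H) = N. *)
Definition is_ramsey_number (r : nat) (G H : r_graph r) (N : nat) : Prop :=
  [/\ 0 < N, ramsey_prop G H N &
      forall n : nat, 0 < n -> ramsey_prop G H n -> N <= n].

(* [ordS] is the cyclic successor on 'I_k.  The covering condition says that
   the cycle has no vertices other than those on its edges; together with the
   other conditions it determines G up to isomorphism when k >= 4. *)
Definition is_linear_cycle (r k : nat) (G : r_graph r) : Prop :=
  exists e : 'I_k -> {set G},
    [/\ injective e,
        edges G = [set e i | i : 'I_k],
        cover (edges G) = [set: G],
        forall i : 'I_k, #|e i :&: e (ordS i)| = 1 &
        forall i j : 'I_k, i != j -> j != ordS i -> i != ordS j ->
          e i :&: e j = set0].

(* Linear cycles exist, so quantifying over them is not vacuous. *)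
Lemma linear_cycle_exists (r k : nat) :
  2 <= r -> 3 <= k -> exists G : r_graph r, is_linear_cycle k G.
Proof.
case: r => [|[|s]] // _ k3.
pose e (i : 'I_k) : {set 'I_k * 'I_s.+1} :=
  (ordS i, ord0) |: setX [set i] setT.
have Si (i : 'I_k) : (ordS i == i) = false.
  apply/negbTE/eqP => /(congr1 val) /=.
  have := ltn_ord i; rewrite leq_eqVlt => /orP[/eqP ik|ik].
    by rewrite ik modnn => i0; rewrite -i0 in ik; rewrite -ik in k3.
  by rewrite modn_small // => /eqP; rewrite eqn_leq ltnn.
have SSi (i : 'I_k) : (ordS (ordS i) == i) = false.
  apply/negbTE/eqP => /(congr1 val) /=.
  rewrite -addn1 modnDml addn1.
  have := ltn_ord i; rewrite leq_eqVlt => /orP[/eqP ik|].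
    rewrite ik -addn1 modnDl modn_small ?(ltnW k3) // => i1.
    by rewrite -i1 in ik; rewrite -ik in k3.
  rewrite leq_eqVlt => /orP[/eqP ik|ik].
    by rewrite ik modnn => i0; rewrite -i0 in ik; rewrite -ik in k3.
  by rewrite modn_small // => /eqP; rewrite eqn_leq ltnNge leqnSn.
have inE_ (i : 'I_k) (x : 'I_k * 'I_s.+1) :
    (x \in e i) = (x == (ordS i, ord0)) || (x.1 == i).
  by rewrite !inE andbT.
have card_e (i : 'I_k) : #|e i| = s.+2.
  by rewrite cardsU1 !inE /= Si cardsX cards1 cardsT card_ord mul1n.
have unif (A : {set 'I_k * 'I_s.+1}) : A \in [set e i | i : 'I_k] -> #|A| = s.+2.
  by case/imsetP => i _ ->.
have inter (i : 'I_k) : e i :&: e (ordS i) = [set (ordS i, ord0)].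
  apply/setP => -[a b]; rewrite in_setI !inE_ !inE !xpair_eqE /=.
  case: (eqVneq a (ordS i)) => [->|nai] /=; rewrite ?Si ?orbT ?orbF ?andbT //.
  by case: (eqVneq a i) => [->|] //=; rewrite eq_sym SSi.
exists (RGraph unif), e; split => //=.
- move=> i j eij; have: (i, ord0) \in e i by rewrite inE_ eqxx orbT.
  rewrite eij inE_ xpair_eqE /= andbT => /orP[/eqP iSj|/eqP//].
  have: (ordS i, ord0) \in e i by rewrite inE_ eqxx.
  rewrite eij inE_ xpair_eqE /= andbT iSj SSi orbF.
  by rewrite Si.
- apply/setP => x; rewrite inE; apply/bigcupP.
  by exists (e x.1); [exact: imset_f | rewrite inE_ eqxx orbT].
- by move=> i; rewrite inter cards1.
- move=> i j ij jSi iSj; apply/setP => -[a b].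
  rewrite in_setI !inE_ in_set0 !xpair_eqE /=; apply/negbTE/negP.
  case/andP => /orP[/andP[/eqP-> _]|/eqP->].
    rewrite (eq_sym _ j) (negbTE jSi) orbF => /andP[/eqP SS _].
    by move/eqP: ij; apply; exact: (can_inj (@ordSK _)) SS.
  by rewrite (negbTE ij) (negbTE iSj).
Qed.

(* Main.v *)
Require Import Defs.
From HB Require Import structures.
From mathcomp Require Import all_boot all_order all_algebra.
From mathcomp Require Import reals exp.
From mathcomp Require Import zify boolp.

(** Let [H] be the red [r]-graph and suppose that it has no linear cycle of
    length [2m+1].  Call a set of at least two vertices robust if it extends to
    edges of [H] avoiding any prescribed bounded set of further vertices.  The
    minimal robust sets form a family [F] such that every edge of [H] contains
    a member of [F], pairs have bounded codegree in [F], and linear cycles of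
    [F] expand to linear cycles of [H].  It is thus enough to find a large
    [F]-independent set.

    Removing greedily an independent set [I] together with a set [W] that meets
    every member of [F] meeting [I], one either collects an independent set of
    size [n / q], or arrives at a nonempty set of vertices in which
    [|I| + |W| > q |I|] for all such [I] and [W].  In the latter case one grows
    a linear tree in [F] level by level.  A level [N] at depth less than [m]
    contains a subset [I] of proportional size no two vertices of which lie in
    a common member of [F] avoiding the rest of the tree.  Otherwise lying in
    a common member gives a graph of large minimum degree on part of [N]; if
    [h] is maximal such that some edge of this graph joins vertices with
    different ancestors [h] levels up, one finds in it a path of the odd length
    [2m+1 - 2(h+1)] whose ends have different ancestors [h] levels up but the
    same one [h+1] levels up, and the tree closes it to a linear cycle of
    length [2m+1].  Expansion from [I] then multiplies the size of the level by
    a constant times [q], so that after [m] levels [n >= (const q)^m].  With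
    [n = q t] this is impossible once [q^(m-1)] exceeds a constant times [t]. *)

Set Implicit Arguments.
Unset Strict Implicit.
Unset Printing Implicit Defensive.

(** * Linear paths and cycles of sets *)

Section LinearPaths.
Variable V : finType.
Implicit Types (f : {set V}) (s q : seq {set V}) (x y z w : V).

Definition cov s : {set V} := \bigcup_(f <- s) f.

Lemma cov_nil : cov [::] = set0.
Proof. by rewrite /cov big_nil. Qed.

Lemma cov_cons f s : cov (f :: s) = f :|: cov s.
Proof. by rewrite /cov big_cons. Qed.

Lemma cov_cat s q : cov (s ++ q) = cov s :|: cov q.
Proof. by rewrite /cov big_cat. Qed.

Lemma cov_rcons s f : cov (rcons s f) = cov s :|: f.
Proof. by rewrite -cats1 cov_cat cov_cons cov_nil setU0. Qed.

Definition covE := (cov_nil, cov_cons, cov_cat, cov_rcons).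

Lemma nth_sub_cov s i : i < size s -> nth set0 s i \subset cov s.
Proof.
elim: s i => // f s IH [|i] /= h; rewrite cov_cons; first exact: subsetUl.
exact: subset_trans (IH i h) (subsetUr _ _).
Qed.

(** The junction [z] is the only vertex that [f] may share with the later sets, so nonconsecutive
    sets are disjoint; [x != z] keeps [x] out of the later sets. *)
Fixpoint lpath x s y : Prop :=
  if s is f :: s' then
    exists z, [/\ x \in f, z \in f, x != z, f :&: cov s' \subset [set z]
                & lpath z s' y]
  else x = y.

Lemma lpath_cat x s y q z : lpath x s y -> lpath y q z ->
  cov s :&: cov q \subset [set y] -> lpath x (s ++ q) z.
Proof.
elim: s x => [x /= -> //|f s IH x] /= [w [xf wf xw fs ws]] yq.
rewrite cov_cons => fsq; exists w; split=> //; last first.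
  by apply: IH => //; apply: subset_trans fsq; rewrite setSI ?subsetUr.
apply/subsetP=> v; rewrite cov_cat !inE => /andP[vf /orP[vs|vq]].
  by move/subsetP: fs => /(_ v); rewrite !inE vf vs => /(_ isT).
have /eqP vy : v == y.
  by move/subsetP: fsq => /(_ v); rewrite !inE vf vq => /(_ isT).
case: s ws fs IH fsq => [/= -> _ _ _ |g s ws fs _ _]; first by apply/eqP.
have ys : y \in cov (g :: s).
  clear -ws; elim: s g w ws => [|h s IH] g w /= [w' [_ wg _ _ wy]].
    by rewrite covE inE -wy wg.
  by rewrite cov_cons inE (IH h w') ?orbT.
by move/subsetP: fs => /(_ v); rewrite !inE vf vy ys => /(_ isT).
Qed.

Lemma lpath1 x y f : x \in f -> y \in f -> x != y -> lpath x [:: f] y.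
Proof. by move=> xf yf xy; exists y; split=> //; rewrite cov_nil setI0 sub0set. Qed.

Lemma lpath_rcons x s y f z : lpath x s y -> y \in f -> z \in f -> y != z ->
  cov s :&: f \subset [set y] -> lpath x (rcons s f) z.
Proof.
move=> xs yf zf yz sf; rewrite -cats1; apply: (lpath_cat xs (lpath1 yf zf yz)).
by rewrite cov_cons cov_nil setU0.
Qed.

Lemma lpath_start x s y i : lpath x s y -> i < size s ->
  (x \in nth set0 s i) = (i == 0).
Proof.
case: s => // f s /= [z [xf _ xz fs _]].
case: i => [|i] /= si; first by rewrite xf.
apply/negbTE/negP=> xi; move/subsetP: fs => /(_ x).
rewrite !inE xf (negbTE xz) /= (subsetP (nth_sub_cov si) _ xi).
by move/(_ isT).
Qed.

Lemma lpath_end x s y i : lpath x s y -> i < size s ->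
  (y \in nth set0 s i) = (i.+1 == size s).
Proof.
elim: s x i => // f s IH x i /= [z [xf zf xz fs zy]].
case: i => [_|i si] /=; last by rewrite eqSS (IH z).
case: s IH fs zy => [_ _ /= <-|g s IH fs zy] //=.
apply/negbTE/negP => yf.
have yl : y \in nth set0 (g :: s) (size s) by rewrite (IH z) /=.
have /eqP yz : y == z.
  move/subsetP: fs => /(_ y); rewrite !inE yf.
  by rewrite (subsetP (nth_sub_cov _) _ yl) //= => /(_ isT).
move: yl; rewrite yz (lpath_start zy) // => /eqP s0.
case: s {IH fs} zy s0 => // [[z' [_ _ zz' _ /= z'y]]] _.
by rewrite z'y yz eqxx in zz'.
Qed.

Lemma lpath_nth x s y i j : lpath x s y -> i < j < size s ->
  #|nth set0 s i :&: nth set0 s j| = (j == i.+1).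
Proof.
elim: s x i j => [x i j _|f s IH x i j /= [z [xf zf xz fs zy]]].
  by rewrite ltn0 andbF.
case: j => // j; case: i => [|i] /= ij; last first.
  by rewrite (IH z).
have sub : f :&: nth set0 s j \subset [set z].
  by apply: subset_trans fs; rewrite setIS ?nth_sub_cov.
rewrite eqSS -(lpath_start zy ij); case: (boolP (z \in _)) => zj.
  suff -> : f :&: nth set0 s j = [set z] by rewrite cards1.
  by apply/eqP; rewrite eqEsubset sub sub1set inE zf zj.
suff -> : f :&: nth set0 s j = set0 by rewrite cards0.
apply/setP=> v; rewrite in_set0; apply/negbTE/negP=> vin.
have := subsetP sub _ vin; rewrite inE => /eqP vz.
by move: vin; rewrite vz inE (negbTE zj) andbF.
Qed.

Definition lcycle f s : Prop :=
  exists x y, [/\ lpath x s y, x \in f, y \in f, x != y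
                & f :&: cov s \subset [set x; y]].

Lemma lcycle_nth f s i j : 1 < size s -> lcycle f s -> i < j <= size s ->
  #|nth set0 (f :: s) i :&: nth set0 (f :: s) j| =
    (j == i.+1) || ((i == 0) && (j == size s)).
Proof.
move=> s1 [x [y [xsy xf yf xy fs]]].
case: j => // j; case: i => [|i] /= ij; last first.
  by rewrite (lpath_nth xsy) // orbF.
have sub : f :&: nth set0 s j \subset [set x; y].
  by apply: subset_trans fs; rewrite setIS ?nth_sub_cov.
have E v : v \in [set x; y] ->
    (v \in f :&: nth set0 s j) = (v \in nth set0 s j).
  by rewrite !inE => /orP[/eqP->|/eqP->]; rewrite ?xf ?yf.
have xj := lpath_start xsy ij; have yj := lpath_end xsy ij.
have {}E v : (v \in f :&: nth set0 s j) =
    (v == x) && (j == 0) || (v == y) && (j.+1 == size s).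
  case: (boolP (v \in [set x; y])) => vxy.
    rewrite E //; move: vxy; rewrite !inE => /orP[/eqP->|/eqP->].
      by rewrite xj eqxx (negbTE xy) orbF.
    by rewrite yj eqxx (eq_sym y x) (negbTE xy).
  move: (vxy); rewrite !inE negb_or => /andP[/negbTE-> /negbTE->] /=.
  by apply/negbTE/negP => /andP[a b]; move/subsetP: sub => /(_ v);
    rewrite in_setI a b (negbTE vxy) => /(_ isT).
rewrite eqSS; case: eqP => [j0|j0] /=.
  rewrite (_ : f :&: _ = [set x]) ?cards1 //; apply/setP=> v.
  by rewrite E !inE j0 eqxx andbT ltn_eqF // andbF orbF.
case: eqP => [js|js] /=.
  rewrite (_ : f :&: _ = [set y]) ?cards1 //; apply/setP=> v.
  by rewrite E !inE js eqxx (introF eqP j0) andbT andbF.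
apply/eqP; rewrite cards_eq0; apply/eqP/setP=> v.
by rewrite E !inE (introF eqP js) (introF eqP j0) !andbF.
Qed.

(** The first set of [s] becomes the closing set: what remains of [s], followed by [q], is a path
    from its junction back to [x]. *)
Lemma lcycle_of_lpaths x y s q : lpath x s y -> lpath y q x -> s != [::] ->
  cov s :&: cov q \subset [set x; y] -> x != y ->
  exists f s', [/\ lcycle f s', perm_eq (f :: s') (s ++ q)
                 & size s' = (size s + size q).-1].
Proof.
case: s => // f s [z [xf zf xz fs zs]] yq _ sq xy.
exists f, (s ++ q); split; [|by []|by rewrite size_cat].
have xs : x \notin cov s.
  apply/negP=> xs; move/subsetP: fs => /(_ x).
  by rewrite !inE xf xs (negbTE xz) => /(_ isT).
exists z, x; split=> //; last 1 first.
- apply/subsetP=> v; rewrite cov_cat !inE => /andP[vf /orP[vs|vq]].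
    by move/subsetP: fs => /(_ v); rewrite !inE vf vs => /(_ isT) ->.
  move/subsetP: sq => /(_ v); rewrite cov_cons !inE vf vq => /(_ isT).
  case: eqP => [_|_ /= /eqP vy]; rewrite ?orbT ?orbF //.
  have := @lpath_end x (f :: s) y 0.
  rewrite /= -vy vf => /(_ (ex_intro _ z (And5 xf zf xz fs _)) isT).
  rewrite vy => /(_ zs) /esym; rewrite eqSS eq_sym size_eq0 => /eqP s0.
  by move: zs; rewrite s0 /= => ->.
- apply: (lpath_cat zs yq).
  apply/subsetP=> v; rewrite !inE => /andP[vs vq].
  move/subsetP: sq => /(_ v); rewrite cov_cons !inE vs vq orbT => /(_ isT).
  by case/orP => // /eqP vx; rewrite vx (negbTE xs) in vs.
- by rewrite eq_sym.
Qed.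

End LinearPaths.

(** * Copies of linear cycles *)

Lemma leq_card_bigcup (I V : finType) (A : {set I}) (F : I -> {set V}) b :
  {in A, forall i, #|F i| <= b} -> #|\bigcup_(i in A) F i| <= #|A| * b.
Proof.
move=> h; rewrite -sum_nat_const.
apply: (@leq_trans (\sum_(i in A) #|F i|)); last exact: leq_sum.
elim/big_ind2: _ => [|m X n Y hX hY|i _]; rewrite ?cards0 //.
exact: leq_trans (leq_card_setU _ _) (leq_add hX hY).
Qed.

(** Each fibre of [kU] is enumerated and sent, position by position, into the fibre of [kV] over the
    same point. *)
Lemma exists_fibrewise_injection (U V T : finType) (kU : U -> T) (kV : V -> T) :
  V -> (forall u, #|[set u' | kU u' == kU u]| <= #|[set v | kV v == kU u]|) ->
  exists2 f : U -> V, injective f & forall u, kV (f u) = kU u.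
Proof.
move=> v0 le.
pose cU a := enum [set u | kU u == a]; pose cV a := enum [set v | kV v == a].
have iU u : index u (cU (kU u)) < size (cV (kU u)).
  rewrite -cardE (leq_trans _ (le u)) // [X in _ < X]cardE index_mem.
  by rewrite mem_enum inE.
pose f u := nth v0 (cV (kU u)) (index u (cU (kU u))).
have fk u : kV (f u) = kU u.
  by have := mem_nth v0 (iU u); rewrite mem_enum inE => /eqP.
exists f => // u w fE.
have kE : kU u = kU w by rewrite -!fk fE.
have := iU u; have := iU w; move: fE; rewrite /f kE => fE iw iu.
move/eqP: fE; rewrite nth_uniq ?enum_uniq // => /eqP.
by move/(index_inj u); apply; rewrite mem_enum inE ?kE.
Qed.

Section CycleFamilies.
Variables (k r : nat).
Hypothesis k_gt3 : 3 < k.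

Definition cycle_family (V : finType) (e : 'I_k -> {set V}) : Prop :=
  [/\ forall i, #|e i| = r, forall i, #|e i :&: e (ordS i)| = 1
    & forall i j, i != j -> j != ordS i -> i != ordS j -> e i :&: e j = set0].

Definition incidence (V : finType) (e : 'I_k -> {set V}) (v : V) : {set 'I_k} :=
  [set i | v \in e i].

Lemma iter_ordS_neq (i : 'I_k) a : 0 < a < k -> iter a (@ordS k) i != i.
Proof.
move=> /andP[a0 ak].
have valE b : val (iter b (@ordS k) i) = (i + b) %% k.
  elim: b => [|b IH]; first by rewrite addn0 modn_small.
  by rewrite iterS /= IH -addn1 modnDml -addnA addn1.
apply/eqP => /(congr1 val); rewrite valE -[RHS](modn_small (ltn_ord i)).
rewrite -[in RHS](addn0 (val i)) => /eqP; rewrite eqn_modDl mod0n.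
by rewrite modn_small // => /eqP a00; rewrite a00 in a0.
Qed.

Let S1 i : ordS i != i :> 'I_k.
Proof. by apply: (@iter_ordS_neq i 1); lia. Qed.
Let S2 i : ordS (ordS i) != i :> 'I_k.
Proof. by apply: (@iter_ordS_neq i 2); lia. Qed.
Let S3 i : ordS (ordS (ordS i)) != i :> 'I_k.
Proof. by apply: (@iter_ordS_neq i 3); lia. Qed.

Section OneFamily.
Variables (V : finType) (e : 'I_k -> {set V}).
Hypothesis ce : cycle_family e.

Lemma meet_adjacent i j v : v \in e i -> v \in e j ->
  [|| j == i, j == ordS i | i == ordS j].
Proof.
case: ce => _ _ dis vi vj; apply/negPn/negP; rewrite !negb_or.
case/and3P => ji jSi iSj.
have := dis i j; rewrite eq_sym ji => /(_ isT jSi iSj)/setP/(_ v).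
by rewrite !inE vi vj.
Qed.

(** The first and third sets could meet only if [i] were its own third successor, which [k > 3]
    excludes; for [k = 3] all three sets might share a vertex. *)
Lemma meet3 i v : v \in e i -> v \in e (ordS i) -> v \in e (ordS (ordS i)) ->
  False.
Proof.
move=> vi _ v2; have := meet_adjacent vi v2.
rewrite (negbTE (S2 i)) (negbTE (S1 _)) /= eq_sym.
by rewrite (negbTE (S3 i)).
Qed.

Lemma incidence_edge i v : v \in e i -> v \in e (ordS i) ->
  incidence e v = [set i; ordS i].
Proof.
move=> vi vS; apply/setP=> j; rewrite !inE.
apply/idP/idP => [vj|/orP[]/eqP-> //].
have /or3P[->//|->|/eqP ij] := meet_adjacent vi vj; first by rewrite orbT.
by rewrite ij in vi vS; case: (meet3 vj vi vS).
Qed.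

Lemma card_incidence2 i :
  #|[set v | incidence e v == [set i; ordS i]]| = 1.
Proof.
case: (ce) => _ e1 _; rewrite -(e1 i); apply: eq_card => v; rewrite !inE.
apply/eqP/andP => [h|[vi vS]]; last exact: incidence_edge.
have E j : (v \in e j) = (j \in [set i; ordS i]) by rewrite -h inE.
by rewrite !E !inE !eqxx orbT.
Qed.

Lemma card_incidence1 i : #|[set v | incidence e v == [set i]]| = r - 2.
Proof.
case: (ce) => er e1 _.
pose p := ord_pred i; have Sp : ordS p = i by rewrite ord_predK.
rewrite (_ : [set v | _] = e i :\: (e i :&: e (ordS i) :|: e p :&: e (ordS p))).
  rewrite cardsD er; congr (_ - _); rewrite (setIidPr _); last first.
    by rewrite subUset subsetIl Sp subsetIr.
  rewrite cardsU !e1 (_ : _ :&: _ = set0) ?cards0 //.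
  apply/setP=> v; rewrite Sp !inE; apply/negbTE/negP.
  case/and3P => /andP[vi vS] vp _.
  by apply: (@meet3 p v); rewrite ?Sp.
apply/setP=> v; rewrite Sp !inE.
apply/eqP/andP => [h|[h vi]].
  have E j : (v \in e j) = (j == i) by move/setP: h => /(_ j); rewrite !inE.
  rewrite !E eqxx (negbTE (S1 i)) /= andbT; split=> //.
  by rewrite -Sp eq_sym S1.
apply/setP=> j; rewrite !inE; apply/idP/eqP => [vj|->//].
have /or3P[/eqP//|/eqP ji|/eqP ij] := meet_adjacent vi vj.
  by move: h; rewrite vi -ji vj.
have jp : j = p by rewrite /p ij ordSK.
by move: h; rewrite -jp vi vj orbT.
Qed.

(** The count depends on [K], [k] and [r] but not on the family, so any two families can be matched
    type by type. *)
Lemma card_incidence (K : {set 'I_k}) : K != set0 ->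
  #|[set v | incidence e v == K]| =
    if [exists i, K == [set i]] then r - 2 else [exists i, K == [set i; ordS i]].
Proof.
move=> K0; case: existsP => [[i /eqP->]|n1]; first exact: card_incidence1.
case: existsP => [[i /eqP->]|n2]; first exact: card_incidence2.
apply/eqP; rewrite cards_eq0; apply/eqP/setP=> v; rewrite !inE.
apply/negbTE/negP=> /eqP vK; have [i iK] := set0Pn _ K0.
have KE j : (v \in e j) = (j \in K) by rewrite -vK inE.
have vi : v \in e i by rewrite KE.
case: (boolP (v \in e (ordS i))) => vS.
  by case: n2; exists i; rewrite -vK (incidence_edge vi vS).
case: (boolP (v \in e (ord_pred i))) => vp.
  case: n2; exists (ord_pred i); rewrite -vK.
  by rewrite (incidence_edge vp) // ord_predK.
case: n1; exists i; apply/eqP/setP=> j; rewrite -KE inE.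
apply/idP/eqP => [vj|->//].
have /or3P[/eqP//|/eqP ji|/eqP ij] := meet_adjacent vi vj.
  by rewrite -ji vj in vS.
by rewrite ij ordSK vj in vp.
Qed.

End OneFamily.

(** An injection preserving incidences sends each edge of [C] into the corresponding [e i], and
    equal cardinality makes the image all of it. Covering excludes the empty incidence, whose counts
    may differ. *)
Lemma cycle_family_copy (G C : r_graph r) (e : 'I_k -> {set G}) :
  G -> cycle_family e -> (forall i, e i \in edges G) -> is_linear_cycle k C ->
  contains_copy G C.
Proof.
move=> v0 ce eG [e' [e'i eC covC e1 e0]].
have e'C i : e' i \in edges C by rewrite eC imset_f.
have ce' : cycle_family e' by split=> // i; apply: edges_uniform.
have inc0 u : incidence e' u != set0.
  have : u \in cover (edges C) by rewrite covC.
  case/bigcupP => E; rewrite eC => /imsetP[i _ ->] ui.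
  by apply/set0Pn; exists i; rewrite inE.
have [|f f_inj fk] := @exists_fibrewise_injection C G _ (incidence e') (incidence e) v0.
  by move=> u; rewrite !card_incidence.
exists f; split=> // E; rewrite eC => /imsetP[i _ ->].
suff -> : f @: e' i = e i by [].
apply/eqP; rewrite eqEcard card_imset //.
case: ce ce' => -> _ _ [-> _ _]; rewrite leqnn andbT.
apply/subsetP=> _ /imsetP[u ui ->].
have : i \in incidence e (f u) by rewrite fk inE.
by rewrite inE.
Qed.

End CycleFamilies.

(** * Robust sets *)

Section Kernels.
Variables (V : finType) (H : {set {set V}}) (r K : nat).
Hypothesis H_unif : {in H, forall e : {set V}, #|e| = r}.

Definition robust (S : {set V}) : bool :=
  (1 < #|S|) &&
  [forall A : {set V}, (#|A| <= K) && [disjoint A & S] ==>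
    [exists e in H, (S \subset e) && [disjoint A & e]]].

Lemma robustP (S : {set V}) : robust S -> forall A : {set V}, #|A| <= K ->
  [disjoint A & S] -> exists2 e, e \in H & S \subset e /\ [disjoint A & e].
Proof.
case/andP => _ /forallP h A AK AS.
have := h A; rewrite AK AS /= => /existsP[e /and3P[eH Se Ae]].
by exists e.
Qed.

Definition kernels : {set {set V}} := [set S | minset robust S].

Lemma kernel_robust f : f \in kernels -> robust f.
Proof. by rewrite inE => /minsetp. Qed.

Lemma card_kernel_gt1 f : f \in kernels -> 1 < #|f|.
Proof. by move/kernel_robust/andP => []. Qed.

Lemma card_robust f : robust f -> #|f| <= r.
Proof.
move=> fr; have [||e eH [fe _]] := @robustP f fr set0.
- by rewrite cards0.
- by rewrite -setI_eq0 set0I.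
by rewrite -(H_unif eH) subset_leq_card.
Qed.

Lemma edge_robust e : 1 < r -> e \in H -> robust e.
Proof.
move=> r1 eH; rewrite /robust H_unif // r1; apply/forallP=> A.
by apply/implyP=> /andP[_ Ae]; apply/existsP; exists e; rewrite eH subxx.
Qed.

Lemma kernel_sub_edge e : 1 < r -> e \in H ->
  exists2 f, f \in kernels & f \subset e.
Proof.
move=> r1 eH; have [f fm fe] := minset_exists (edge_robust r1 eH).
by exists f; rewrite ?inE.
Qed.

(* A set [Z] that is not robust has a small transversal [A] of all the edges
   above it, hence of all the robust sets above it. *)
Lemma card_kernels_above (Z : {set V}) : 0 < K -> 1 < #|Z| ->
  #|[set f in kernels | Z \subset f]| <= K ^ (r - #|Z|).
Proof.
move=> K0; move En : (r - #|Z|) => n; elim: n Z En => [|n IH] Z En Z1.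
  rewrite expn0 -(cards1 Z) subset_leq_card //.
  apply/subsetP=> f; rewrite inE => /andP[fk Zf]; rewrite inE eq_sym eqEcard Zf.
  by have := card_robust (kernel_robust fk); lia.
case: (boolP (robust Z)) => [Zr|].
  rewrite (@leq_trans 1) ?expn_gt0 ?K0 // -(cards1 Z) subset_leq_card //.
  apply/subsetP=> f; rewrite 2!inE => /andP[fk Zf]; rewrite inE eq_sym.
  by case/minsetP: fk => _ /(_ Z Zr Zf) ->.
rewrite /robust Z1 /= => /forallPn[A]; rewrite negb_imply.
case/andP => /andP[AK AZ] noe.
have cov : [set f in kernels | Z \subset f] \subset
    \bigcup_(a in A) [set f in kernels | a |: Z \subset f].
  apply/subsetP=> f; rewrite inE => /andP[fk Zf].
  case: (boolP [disjoint A & f]) => Af.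
    have [e eH [fe Ae]] := robustP (kernel_robust fk) AK Af.
    case/negP: noe; apply/existsP; exists e.
    by rewrite eH Ae (subset_trans Zf).
  case/pred0Pn: Af => a /andP[/= aA af]; apply/bigcupP; exists a => //.
  by rewrite inE fk subUset sub1set af.
apply: leq_trans (subset_leq_card cov) _.
rewrite expnS; apply: leq_trans (leq_mul AK (leqnn _)).
apply: leq_card_bigcup => a aA.
have aZ : a \notin Z.
  by move: AZ; rewrite disjoint_subset => /subsetP/(_ a aA); rewrite inE.
by apply: IH; rewrite cardsU1 aZ; lia.
Qed.

(** The sets are replaced by edges one at a time. Each new edge avoids the at most [r * k] vertices
    of the current members outside the set it replaces, so pairwise intersections are unchanged;
    edges are robust themselves, so the process can go on. *)
Lemma expand_family k (g : 'I_k -> {set V}) : 1 < r -> r * k <= K ->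
  (forall i, robust (g i)) ->
  exists2 e : 'I_k -> {set V}, (forall i, e i \in H) &
    forall i j, i != j -> e i :&: e j = g i :&: g j.
Proof.
move=> r1 rkK gr.
suff [e [_ eH eg]] : exists e : 'I_k -> {set V},
    [/\ forall i, robust (e i), {in enum 'I_k, forall i, e i \in H}
      & forall i j, i != j -> e i :&: e j = g i :&: g j].
  by exists e => // i; apply: eH; rewrite mem_enum.
elim: (enum _) => [|i s [e [er es eg]]]; first by exists g.
pose A := (\bigcup_j e j) :\: e i.
have AK : #|A| <= K.
  apply: leq_trans rkK; apply: leq_trans (subset_leq_card (subsetDl _ _)) _.
  apply: (@leq_trans (#|[set: 'I_k]| * r)); last by rewrite cardsT card_ord mulnC.
  rewrite (eq_bigl (fun j => j \in [set: 'I_k])); last by move=> j; rewrite inE.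
  by apply: leq_card_bigcup => j _; apply: card_robust.
have Ai : [disjoint A & e i].
  by rewrite -setI_eq0 /A setDE -setIA (setIC (~: _)) setICr setI0.
have [E EH [eE AE]] := robustP (er i) AK Ai.
have EI j : i != j -> E :&: e j = e i :&: e j.
  move=> ij; apply/eqP; rewrite eqEsubset andbC setSI //=.
  apply/subsetP=> v; rewrite !inE => /andP[vE vj]; rewrite vj andbT.
  apply/negPn/negP=> vi.
  move: AE; rewrite disjoint_sym disjoint_subset => /subsetP/(_ v vE).
  by rewrite !inE vi /= => /negP[]; apply/bigcupP; exists j.
exists (fun j => if j == i then E else e j); split.
- by move=> j; case: eqP => // _; apply: edge_robust.
- by move=> j; rewrite inE; case: eqP => //= _; apply: es.
move=> j l jl; case: (eqVneq j i) jl => [->|ji] jl.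
  by rewrite eq_sym (negbTE jl) EI ?eg.
by case: (eqVneq l i) jl => [->|li] jl; rewrite ?eg // setIC EI 1?eq_sym // setIC eg.
Qed.

End Kernels.

(** * Expansion and the tree *)

Section Greedy.
Variables (V : finType) (F : {set {set V}}) (q : nat).
Hypothesis F_neq0 : {in F, forall f : {set V}, f != set0}.

Definition independent (J : {set V}) : Prop :=
  {in F, forall f : {set V}, ~~ (f \subset J)}.

Definition expanding (X : {set V}) : Prop :=
  X != set0 /\ forall I W : {set V}, I != set0 -> I \subset X -> W \subset X ->
    [disjoint I & W] ->
    {in F, forall f : {set V}, f \subset X -> f :&: I != set0 -> f :&: W != set0} ->
    q * #|I| < #|I| + #|W|.

(** While [X] is not expanding, [I] is kept and [I :|: W] deleted, at a cost of at most [q] vertices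
    for each one kept. A member of [F] inside [J :|: I] that meets [I] would have to meet [W], which
    is disjoint from this union. *)
Lemma greedy_independent (X : {set V}) :
  (forall Y : {set V}, Y \subset X -> ~ expanding Y) ->
  exists J : {set V}, [/\ J \subset X, independent J & #|X| <= q * #|J|].
Proof.
have [n] := ubnP #|X|; elim: n X => // n IH X /ltnSE Xn noexp.
case: (eqVneq X set0) => [->|X0].
  exists set0; split; rewrite ?sub0set ?cards0 // => f /F_neq0.
  by rewrite subset0.
have [I [W [I0 IX WX IW [bl le]]]] : exists I W : {set V},
    [/\ I != set0, I \subset X, W \subset X, [disjoint I & W] &
    {in F, forall f : {set V}, f \subset X -> f :&: I != set0 -> f :&: W != set0}
    /\ #|I| + #|W| <= q * #|I|].
  apply: contrapT => no; apply: (noexp X) => //; split=> // I W I0 IX WX IW bl.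
  by rewrite ltnNge; apply/negP => le; apply: no; exists I, W.
pose X1 := X :\: (I :|: W).
have cX : #|X| = #|X1| + (#|I| + #|W|).
  rewrite -(cardsID (I :|: W) X) addnC (setIidPr _) ?subUset ?IX //; congr (_ + _).
  by rewrite cardsU disjoint_setI0 // cards0 subn0.
have I1 : 0 < #|I| by rewrite card_gt0.
have [||J [JX Ji Jq]] := IH X1; first by lia.
  by move=> Y YX; apply: noexp; apply: subset_trans YX (subsetDl _ _).
have JIW : [disjoint J & I :|: W].
  rewrite disjoint_subset; apply/subsetP=> v /(subsetP JX).
  by rewrite in_setD => /andP[].
exists (J :|: I); split.
- by rewrite subUset IX (subset_trans JX (subsetDl _ _)).
- move=> f fF; apply/negP=> fJI.
  have fX : f \subset X.
    by rewrite (subset_trans fJI) // subUset IX (subset_trans JX (subsetDl _ _)).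
  case: (eqVneq (f :&: I) set0) => [fI|fI].
    case/negP: (Ji f fF); apply/subsetP=> v vf.
    move/subsetP: fJI => /(_ v vf); rewrite inE => /orP[//|vI].
    by move/setP: fI => /(_ v); rewrite !inE vf vI.
  have /set0Pn[v] := bl f fF fX fI; rewrite inE => /andP[vf vW].
  move/subsetP: fJI => /(_ v vf); rewrite inE => /orP[vJ|vI].
    move: JIW; rewrite disjoint_subset => /subsetP/(_ v vJ).
    by rewrite !inE vW orbT.
  by move: IW; rewrite disjoint_subset => /subsetP/(_ v vI); rewrite inE vW.
- have -> : #|J :|: I| = #|J| + #|I|.
    rewrite cardsU disjoint_setI0 ?cards0 ?subn0 //.
    by rewrite (disjointWr _ JIW) ?subsetUl.
  by rewrite mulnDr cX leq_add.
Qed.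

End Greedy.

(** * Growing a linear tree level by level *)

Section Levels.
Variables (V : finType) (F : {set {set V}}) (X : {set V}) (r D m q : nat).

(** [K] bounds the number of vertices to be avoided while building a cycle; [B] exceeds the number
    of vertices reachable from [z] by members that meet a given set of [K] vertices outside [z]. *)
Let K := r * (2 * m + 2).
Let B := (K * D * r).+1.

Hypothesis F_sub : {in F, forall f : {set V}, f \subset X}.
Hypothesis F_gt1 : {in F, forall f : {set V}, 1 < #|f|}.
Hypothesis F_le : {in F, forall f : {set V}, #|f| <= r}.
Hypothesis codegree : forall z w : V, z != w ->
  #|[set f in F | [set z; w] \subset f]| <= D.
Hypothesis no_cycle : forall f s, lcycle f s -> size s = 2 * m ->
  {subset f :: s <= F} -> False.

(* [T] is the vertex set of a linear tree of edges of [F], [N] its set of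
   leaves, all at depth [i], and [a h x] the ancestor of the leaf [x] that is
   [h] levels up. *)
Record level (i : nat) (T N : {set V}) (a : nat -> V -> V) : Prop := Level {
  level_sub : N \subset T;
  level_anc0 : {in N, forall x, a 0 x = x};
  level_root : {in N &, forall x y, a i x = a i y};
  level_path : forall x y h, x \in N -> y \in N ->
    a h.+1 x = a h.+1 y -> a h x != a h y ->
    exists p, [/\ lpath x p y, size p = h.+1.*2, {subset p <= F},
      cov p \subset T & cov p :&: N \subset [set x; y]] }.

(** * Large subsets of a level without adjacent pairs *)

Section Colouring.
Variables (i : nat) (T N : {set V}) (a : nat -> V -> V).
Hypothesis lev : level i T N a.
Hypothesis i_lt_m : i < m.

Definition link (f : {set V}) (x y : V) : bool :=
  [&& f \in F, x \in f, y \in f, x != y & [disjoint f & T :\: N]].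

Definition adj (x y : V) : bool := [exists f, link f x y].

Lemma link_sym f x y : link f x y = link f y x.
Proof. by rewrite /link; congr (_ && _); rewrite andbCA (eq_sym x). Qed.

Lemma adj_sym x y : adj x y = adj y x.
Proof. by apply: eq_existsb => f; rewrite link_sym. Qed.

Section MinDegree.
Variable Y : {set V}.
Hypothesis YN : Y \subset N.
Hypothesis min_degree : {in Y, forall z, B <= #|[set y in Y | adj z y]|}.

(** A neighbour of [z] fails only if its links contain, besides [z], some other [w] in [S]; by the
    codegree bound such members cover at most [K * D * r] vertices, fewer than [B]. *)
Lemma avoiding_link z (S : {set V}) : z \in Y -> #|S| <= K ->
  exists y f, [/\ y \in Y, link f z y & f :&: S \subset [set z]].
Proof.
move=> zY SK; apply: contrapT => no.
have := min_degree zY; rewrite leqNgt => /negP[]; rewrite ltnS.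
apply: (@leq_trans #|\bigcup_(w in S :\ z)
    \bigcup_(f in [set f in F | [set z; w] \subset f]) f|).
  apply/subset_leq_card/subsetP=> y; rewrite inE => /andP[yY /existsP[f fzy]].
  have /subsetPn[w wfS wz] : ~~ (f :&: S \subset [set z]).
    by apply/negP=> fS; apply: no; exists y, f.
  move: wfS wz; rewrite !inE => /andP[wf wS] wz.
  case/and5P: fzy => fF zf yf zy _.
  apply/bigcupP; exists w; first by rewrite !inE wz.
  by apply/bigcupP; exists f => //; rewrite inE fF subUset !sub1set zf wf.
apply: (@leq_trans (#|S :\ z| * (D * r))); last first.
  by rewrite -mulnA leq_mul // (leq_trans _ SK) // subset_leq_card ?subsetDl.
apply: leq_card_bigcup => w; rewrite !inE => /andP[wz _].
apply: leq_trans (leq_card_bigcup (b := r) _) _.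
  by move=> f; rewrite inE => /andP[/F_le].
by rewrite leq_mul // codegree // eq_sym.
Qed.

Variable h : nat.
Hypothesis anc_adj : {in Y &, forall x y, adj x y -> a h.+1 x = a h.+1 y}.

(** By symmetry of [adj], ancestors then alternate along a walk, so parity decides the ancestor of
    its end. *)
Definition locally_constant : Prop :=
  forall z y y', z \in Y -> y \in Y -> y' \in Y -> adj z y -> adj z y' ->
  a h y = a h y'.

Lemma grow_path l z (S : {set V}) : z \in Y -> #|S| + r * l <= K ->
  exists s w, [/\ lpath z s w, size s = l,
    {in s, forall f, (f \in F) && [disjoint f & T :\: N]},
    cov s :&: S \subset [set z] & w \in Y] /\
    a h.+1 w = a h.+1 z /\
    (locally_constant -> {in Y, forall y, adj z y ->
       a h w = if odd l then a h y else a h z}).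
Proof.
elim: l z S => [|l IH] z S zY SK.
  exists [::], z; split; split=> //.
  by rewrite cov_nil set0I sub0set.
have [|z' [f [z'Y fl fS]]] := @avoiding_link z S zY; first by lia.
have zz' : adj z z' by apply/existsP; exists f.
case/and5P: (fl) => fF zf z'f zz'n fT.
(* Adding [f] to the forbidden set makes the rest of the path meet [f] only in [z']. *)
have [|s [w [[ps ss sF sS wY] [aw par]]]] := IH z' (S :|: f) z'Y.
  rewrite (leq_trans _ SK) // mulnS addnA leq_add2r.
  by rewrite (leq_trans (leq_card_setU _ _)) // leq_add2l F_le.
exists (f :: s), w; split; last split.
- split=> //=; last 2 first.
  + by move=> g; rewrite inE => /orP[/eqP->|/sF//]; rewrite fF fT.
  + apply/subsetP=> v; rewrite cov_cons !inE => /andP[/orP[vf|vs] vS].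
      by move/subsetP: fS => /(_ v); rewrite !inE vf vS => /(_ isT).
    have /eqP vz' : v == z'.
      by move/subsetP: sS => /(_ v); rewrite !inE vs vS => /(_ isT).
    by move/subsetP: fS => /(_ v); rewrite !inE vS vz' z'f => /(_ isT).
  + exists z'; split=> //; apply/subsetP=> v; rewrite in_setI => /andP[vf vs].
    by apply: (subsetP sS); rewrite !inE vs vf orbT.
  + by rewrite ss.
- by rewrite aw (anc_adj zY z'Y).
- move=> lc y yY zy /=; rewrite (par lc z zY) ?(adj_sym z') //.
  by rewrite if_neg (lc z z' y).
Qed.

(** If the ancestors at height [h] differed, the tree would join [y] to [x] by [2(h+1)] sets meeting
    [N] only at these ends. As [p] avoids the tree outside [N], the two paths would close to a
    linear cycle of [2m+1] sets. *)
Lemma no_bichromatic_path x y p : h.+1 < m -> x \in N -> y \in N ->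
  lpath x p y -> size p = (m - h.+1).*2.+1 ->
  {in p, forall f, (f \in F) && [disjoint f & T :\: N]} ->
  a h.+1 x = a h.+1 y -> a h x = a h y.
Proof.
move=> hm xN yN pp sp pF axy; apply/eqP/negPn/negP=> nxy.
have nyx : a h y != a h x by rewrite eq_sym.
have [t [tp st tF tT tN]] := level_path lev yN xN (esym axy) nyx.
have xy : x != y by apply: contraNneq nxy => ->.
have pT : cov p :&: (T :\: N) = set0.
  apply/setP=> v; rewrite in_set0; apply/negbTE/negP; rewrite inE.
  case/andP => vp vT; move: vp; rewrite /cov bigcup_seq => /bigcupP[f fp vf].
  have /andP[_] := pF f fp; rewrite disjoint_subset => /subsetP/(_ v vf).
  by rewrite inE vT.
have [|||f [s [cfs per ss]]] := lcycle_of_lpaths pp tp.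
- by rewrite -size_eq0 sp.
- apply/subsetP=> v; rewrite inE => /andP[vp vt].
  have vN : v \in N.
    move/setP: pT => /(_ v); rewrite !inE vp (subsetP tT) //= andbT.
    by move/negbFE.
  by move/subsetP: tN => /(_ v); rewrite !inE vt vN orbC => /(_ isT).
- exact: xy.
apply: (no_cycle cfs); first by rewrite ss sp st addSn -doubleD subnK ?mul2n ?(ltnW hm).
by move=> g; rewrite (perm_mem per) mem_cat => /orP[/pF/andP[]//|/tF//].
Qed.

(** A link put before a path of even length [l] that avoids it gives an odd path, whose ends agree
    at height [h]. One path serving two neighbours of [z] proves local constancy; then, by parity,
    the far end of an even path has the ancestor of its start. *)
Lemma anc_adj_descend : h.+1 < m -> {in Y &, forall x y, adj x y -> a h x = a h y}.
Proof.
move=> hm; set l := (m - h.+1).*2.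
have ext z (S : {set V}) s w (f : {set V}) x : z \in Y -> x \in Y -> w \in Y ->
    [/\ lpath z s w, size s = l,
    {in s, forall g, (g \in F) && [disjoint g & T :\: N]} &
    cov s :&: S \subset [set z]] -> a h.+1 w = a h.+1 z ->
    f \subset S -> link f x z -> a h x = a h w.
  move=> zY xY wY [ps ss sF sS] aw fS fl; case/and5P: (fl) => fF xf zf xz fT.
  apply: (@no_bichromatic_path x w (f :: s)) => //=.
  - exact: (subsetP YN).
  - exact: (subsetP YN).
  - exists z; split=> //; apply/subsetP=> v; rewrite in_setI => /andP[vf vs].
    by apply: (subsetP sS); rewrite inE vs (subsetP fS).
  - by rewrite ss.
  - by move=> g; rewrite inE => /orP[/eqP->|/sF//]; rewrite fF fT.
  - by rewrite aw (anc_adj xY zY) //; apply/existsP; exists f.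
have lK : r + r + r * l <= K.
  by rewrite addnn -mul2n mulnC -mulnDr leq_mul // /l; lia.
have lc : locally_constant.
  move=> z y y' zY yY y'Y; rewrite adj_sym (adj_sym z).
  case/existsP => f fl /existsP[f' f'l].
  have [|s [w [[ps ss sF sS wY] [aw _]]]] := @grow_path l z (f :|: f') zY.
    rewrite (leq_trans _ lK) // leq_add2r (leq_trans (leq_card_setU _ _)) //.
    by case/and5P: fl f'l => fF _ _ _ _ /and5P[f'F _ _ _ _]; rewrite leq_add ?F_le.
  rewrite (ext z (f :|: f') s w f y) ?subsetUl //.
  by rewrite (ext z (f :|: f') s w f' y') ?subsetUr.
move=> x y xY yY xy; have /existsP[f fl] := xy.
have [|s [w [[ps ss sF sS wY] [aw par]]]] := @grow_path l y f yY.
  rewrite (leq_trans _ lK) // leq_add2r (leq_trans _ (leq_addr _ _)) //.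
  by case/and5P: fl => fF _ _ _ _; apply: F_le.
rewrite (ext y f s w f x) // (par lc x xY) ?(adj_sym y) //.
by rewrite /l odd_double.
Qed.

End MinDegree.

(** Greedy selection is applied to the graph [adj]. If it fails, singletons in the expanding set [Y]
    give minimum degree [B], and [anc_adj_descend] contradicts the choice of the largest height at
    which adjacent vertices have different ancestors. *)
Lemma colour_level : exists I : {set V},
  [/\ I \subset N, {in I &, forall x y, ~~ adj x y} & #|N| <= B * #|I|].
Proof.
pose F2 := [set [set xy.1; xy.2] | xy in [pred xy : V * V | adj xy.1 xy.2]].
have F2_neq0 : {in F2, forall f : {set V}, f != set0}.
  by move=> f /imsetP[xy _ ->]; apply/set0Pn; exists xy.1; rewrite !inE eqxx.
case: (pselect (exists2 Y : {set V}, Y \subset N & expanding F2 B Y)); last first.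
  move=> no; have [|J [JN Ji Jq]] := greedy_independent (q := B) (X := N) F2_neq0.
    by move=> Y YN Ye; apply: no; exists Y.
  exists J; split=> // x y xJ yJ; apply/negP=> xy.
  have /Ji/negP[] : [set x; y] \in F2 by apply/imsetP; exists (x, y).
  by rewrite subUset !sub1set xJ yJ.
case=> Y YN [Y0 Yexp]; exfalso.
have Ydeg : {in Y, forall z, B <= #|[set y in Y | adj z y]|}.
  move=> z zY; have := Yexp [set z] [set y in Y | adj z y].
  rewrite cards1 muln1 add1n ltnS; apply.
  - by apply/set0Pn; exists z; rewrite inE.
  - by rewrite sub1set.
  - by apply/subsetP=> y; rewrite inE => /andP[].
  - rewrite disjoints1 inE negb_and; apply/orP; right.
    by apply/negP => /existsP[f /and5P[_ _ _]]; rewrite eqxx.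
  move=> _ /imsetP[[x y] /= xy ->]; rewrite inE /= in xy.
  rewrite subUset !sub1set => /andP[xY yY] /set0Pn[v].
  rewrite !inE => /andP[/orP[]/eqP-> /eqP vz]; apply/set0Pn.
    by exists y; rewrite !inE -vz eqxx orbT yY.
  by exists x; rewrite !inE -vz eqxx xY adj_sym.
(* Height [0] qualifies since leaves are their own ancestors; the bound [h < i] reflects the common
   root at height [i] and yields [h.+1 < m]. *)
pose P h := (h < i) && [exists x in Y, exists y in Y, adj x y && (a h x != a h y)].
have [u uY] := set0Pn _ Y0.
have [v] : exists v, v \in [set y in Y | adj u y].
  by apply/set0Pn; rewrite -card_gt0 (leq_trans _ (Ydeg u uY)).
rewrite inE => /andP[vY uv].
have uvn : a 0 u != a 0 v.
  rewrite !(level_anc0 lev) ?(subsetP YN) //.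
  by case/existsP: uv => f /and5P[].
have exP : exists h, P h.
  exists 0; apply/andP; split.
    rewrite lt0n; apply: contra uvn => /eqP i0.
    by have := level_root lev; rewrite i0 => root; rewrite (root u v) ?(subsetP YN).
  apply/existsP; exists u; rewrite uY; apply/existsP; exists v.
  by rewrite vY uv.
have ubP h : P h -> h <= i by case/andP => /ltnW.
case: (ex_maxnP exP ubP) => h /andP[hi Ph] hmax.
have anc : {in Y &, forall x y, adj x y -> a h.+1 x = a h.+1 y}.
  move=> x y xY yY xy; have := hi; rewrite leq_eqVlt => /orP[/eqP->|hi'].
    by apply: (level_root lev); apply: (subsetP YN).
  apply/eqP/negPn/negP=> ne; suff /hmax : P h.+1 by rewrite ltnn.
  rewrite /P hi'; apply/existsP; exists x; rewrite xY; apply/existsP; exists y.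
  by rewrite yY xy.
case/existsP: Ph => x /andP[xY /existsP[y /and3P[yY xy]]].
have hm : h.+1 < m := leq_ltn_trans hi i_lt_m.
by rewrite (anc_adj_descend YN Ydeg anc hm xY yY xy) eqxx.
Qed.
End Colouring.

Hypothesis r_gt0 : 0 < r.
Hypothesis q_large : 4 * r * B <= q.
Hypothesis X_expands : forall I W : {set V}, I != set0 -> I \subset X ->
  W \subset X -> [disjoint I & W] ->
  {in F, forall f : {set V}, f :&: I != set0 -> f :&: W != set0} ->
  q * #|I| < #|I| + #|W|.

(** * Extending the tree by one level *)

Section Extension.
Variables (i : nat) (T N : {set V}) (a : nat -> V -> V).
Hypothesis lev : level i T N a.
Hypothesis TX : T \subset X.

(** Several members may hang from the same vertex of [I]; outside [I] they are disjoint from each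
    other and from the tree. *)
Definition spread (I : {set V}) (M : {set {set V}}) : bool :=
  [forall f in M, [&& f \in F, #|f :&: I| == 1 & [disjoint f & T :\: I]]] &&
  [forall f in M, forall g in M, (f != g) ==> [disjoint f :\: I & g :\: I]].

(** For maximal [M], the set [W] meets every member of [F] that meets [I]: a member missing [W]
    meets [I] only once, as [I] has no adjacent pair, and could be added to [M]. Expansion then
    bounds [M] from below. *)
Lemma maximal_spread (I : {set V}) : I != set0 -> I \subset N ->
  {in I &, forall x y, ~~ adj T N x y} ->
  exists2 M : {set {set V}}, spread I M & q * #|I| < #|T| + r * #|M|.
Proof.
move=> I0 IN Iadj.
have [M Mmax _] : {M | maxset (spread I) M & set0 \subset M}.
  by apply: maxset_exists; apply/andP; split; apply/forallP=> f; rewrite inE.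
have /andP[/forallP Mf /forallP Md] := maxsetp Mmax.
exists M; first exact: maxsetp Mmax.
have IT : I \subset T := subset_trans IN (level_sub lev).
pose W := (T :\: I) :|: \bigcup_(f in M) (f :\: I).
have WI : [disjoint I & W].
  rewrite disjoint_subset; apply/subsetP=> v vI; rewrite !inE vI /=.
  by apply/bigcupP => -[f _]; rewrite inE vI.
have WX : W \subset X.
  rewrite subUset (subset_trans (subsetDl _ _) TX); apply/bigcupsP=> f fM.
  have := Mf f; rewrite fM => /and3P[fF _ _].
  exact: subset_trans (subsetDl _ _) (F_sub fF).
apply: leq_trans (X_expands I0 (subset_trans IT TX) WX WI _) _; last first.
  rewrite -(cardsID I T) (setIidPr IT) -addnA leq_add2l.
  rewrite (leq_trans (leq_card_setU _ _)) // leq_add2l mulnC.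
  apply: leq_card_bigcup => f fM; have := Mf f; rewrite fM => /and3P[fF _ _].
  exact: leq_trans (subset_leq_card (subsetDl _ _)) (F_le fF).
move=> f fF /set0Pn[x]; rewrite inE => /andP[xf xI].
apply/negP=> /eqP fW.
have fW' v : v \in f -> v \notin W.
  by move=> vf; apply/negP=> vW; move/setP: fW => /(_ v); rewrite !in_setI vf vW inE.
have fT : [disjoint f & T :\: I].
  rewrite disjoint_subset; apply/subsetP=> v /fW'.
  by rewrite in_setU negb_or => /andP[].
have fI : f :&: I = [set x].
  apply/eqP; rewrite eqEsubset sub1set in_setI xf xI !andbT.
  apply/subsetP=> y; rewrite !inE => /andP[yf yI]; apply/negPn/negP=> yx.
  case/negP: (Iadj x y xI yI); apply/existsP; exists f.
  rewrite /link fF xf yf eq_sym yx /=; apply: disjointWr fT.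
  exact: setDS.
have MfE : f |: M = M.
  apply: (maxsetsup Mmax); last exact: subsetUr.
  have fg g : g \in M -> [disjoint f :\: I & g :\: I].
    move=> gM; rewrite disjoint_subset; apply/subsetP=> v.
    rewrite inE => /andP[_ /fW' vW]; rewrite inE; apply: contra vW => vg.
    by rewrite in_setU; apply/orP; right; apply/bigcupP; exists g.
  apply/andP; split; apply/forallP=> g; apply/implyP; rewrite !inE.
    case/orP => [/eqP->|gM]; last by have := Mf g; rewrite gM.
    by rewrite fF fI cards1 fT.
  move=> gfM; apply/forallP=> g'; apply/implyP; rewrite !inE => g'fM.
  apply/implyP=> gg'.
  case/orP: gfM gg' => [/eqP->|gM]; case/orP: g'fM => [/eqP->|g'M].
  - by rewrite eqxx.
  - by move=> _; apply: fg.
  - by move=> _; rewrite disjoint_sym; apply: fg.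
  - have := Md g; rewrite gM => /forallP/(_ g').
    by rewrite g'M /= => /implyP.
(* Since [f] is in [M], [f :\: I] lies in [W]; but [f] misses [W], so it would be the single vertex
   [x], against [F_gt1]. *)
have fM : f \in M by rewrite -MfE !inE eqxx.
have : f \subset f :&: I.
  apply/subsetP=> v vf; rewrite inE vf /=; apply/negPn/negP=> vI.
  case/negP: (fW' v vf); rewrite in_setU; apply/orP; right; apply/bigcupP.
  by exists f => //; rewrite inE vI.
by move/subset_leq_card; rewrite fI cards1 leqNgt F_gt1.
Qed.

(** Each member of [M] contributes one new leaf, its [tip], whose parent is the vertex shared with
    [I]. Paths between distinct parents are prolonged at both ends; leaves with one parent are
    joined through it. *)
Lemma extend_level (I : {set V}) (M : {set {set V}}) :
  I != set0 -> I \subset N -> spread I M ->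
  exists N' a', level i.+1 (T :|: \bigcup_(f in M) f) N' a' /\ #|N'| = #|M|.
Proof.
case/set0Pn => x0 x0I IN /andP[/forallP Mf /forallP Md].
have {Mf}MF f : f \in M -> [/\ f \in F, #|f :&: I| = 1 & [disjoint f & T :\: I]].
  by move=> fM; have := Mf f; rewrite fM => /and3P[fF /eqP fI fT].
have {Md}MD f g v : f \in M -> g \in M -> v \in f -> v \in g -> v \notin I ->
    f = g.
  move=> fM gM vf vg vI; apply/eqP/negPn/negP=> fg.
  have := Md f; rewrite fM => /forallP/(_ g); rewrite gM fg /=.
  rewrite disjoint_subset => /subsetP/(_ v); rewrite !inE vI vf vg.
  by move/(_ isT).
pose tip f := odflt x0 [pick v in f :\: I].
have tipP f : f \in M -> (tip f \in f) /\ (tip f \notin I).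
  move=> fM; rewrite /tip; case: pickP => [v|no] /=.
    by rewrite inE => /andP[].
  have [fF f1 _] := MF f fM; have := F_gt1 fF.
  rewrite -(cardsID I f) f1 (_ : f :\: I = set0) ?cards0 //.
  by apply/setP=> v; rewrite no inE.
pose N' := tip @: M.
pose g x := odflt set0 [pick f in M | tip f == x].
have gP x : x \in N' -> (g x \in M) /\ (tip (g x) = x).
  case/imsetP => f fM xE; rewrite /g; case: pickP => [f' /andP[? /eqP]|] //=.
  by move/(_ f); rewrite fM xE eqxx.
pose p x := odflt x0 [pick v in g x :&: I].
have pP x : x \in N' -> g x :&: I = [set p x].
  case/gP => gM _; have [_ /eqP/cards1P[v gv] _] := MF _ gM.
  rewrite /p; case: pickP => [w|/(_ v)]; rewrite gv /=.
    by rewrite inE => /eqP->.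
  by rewrite inE eqxx.
have xg x : x \in N' -> x \in g x.
  by move=> xN; have [gM gx] := gP x xN; have [] := tipP _ gM; rewrite gx.
have xI x : x \in N' -> x \notin I.
  by move=> xN; have [gM gx] := gP x xN; have [] := tipP _ gM; rewrite gx.
have pg x : x \in N' -> p x \in g x.
  by move=> xN; have := set11 (p x); rewrite -pP // in_setI => /andP[].
have pI x : x \in N' -> p x \in I.
  by move=> xN; have := set11 (p x); rewrite -pP // in_setI => /andP[].
have xp x : x \in N' -> x != p x.
  by move=> xN; apply: contraNneq (xI x xN) => ->; apply: pI.
have gI x v : x \in N' -> v \in g x -> v \in I -> v = p x.
  by move=> xN vg vI; apply/set1P; rewrite -pP // inE vg.
have gT x v : x \in N' -> v \in g x -> v \in T -> v = p x.
  move=> xN vg vT; apply: gI => //; have [gM _] := gP x xN.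
  have [_ _] := MF _ gM; rewrite disjoint_subset => /subsetP/(_ v vg).
  by rewrite !inE vT andbT negbK.
have gN x y : x \in N' -> y \in N' -> y \in g x -> y = x.
  move=> xN yN yg; have [gxM <-] := gP x xN; have [gyM <-] := gP y yN.
  by congr tip; apply: (MD _ _ y) => //; [apply: xg | apply: xI].
have gF x : x \in N' -> g x \in F by case/gP => /MF[].
have gU x : x \in N' -> g x \subset \bigcup_(f in M) f.
  by case/gP => gM _; apply: (bigcup_max (g x)).
have gg x y v : x \in N' -> y \in N' -> x != y -> v \in g x -> v \in g y ->
    v = p x /\ v = p y.
  move=> xN yN xy vx vy.
  suff vI : v \in I by split; apply: gI.
  apply/negPn/negP=> vI; case/eqP: xy.
  have [gxM <-] := gP x xN; have [gyM <-] := gP y yN.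
  by rewrite (MD _ _ v gxM gyM).
have NT x : x \in N' -> x \notin T.
  move=> xN; apply/negP=> xT; case/negP: (xI x xN).
  by rewrite (gT x x xN (xg x xN) xT) pI.
have pN x : x \in N' -> p x \in N by move=> xN; apply: (subsetP IN); apply: pI.
exists N', (fun h x => if h is h'.+1 then a h' (p x) else x).
split; last first.
  rewrite card_in_imset // => f f' fM f'M ff'.
  have [tf tI] := tipP f fM; have [tf' _] := tipP f' f'M.
  by apply: (MD _ _ (tip f)) => //; rewrite ff'.
split=> //.
- apply/subsetP=> x xN; rewrite inE (subsetP (gU x xN)) ?orbT //.
  exact: xg.
- by move=> x y xN yN; apply: (level_root lev); apply: pN.
move=> x y [|h] xN yN axy nxy.
  move: axy; rewrite !(level_anc0 lev) ?pN // => pxy.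
  exists [:: g x; g y]; split=> //.
  - exists (p x); split; rewrite ?xg ?pg ?xp //.
      apply/subsetP=> v; rewrite cov_cons cov_nil setU0 in_setI => /andP[vx vy].
      by rewrite inE; have [-> _] := gg x y v xN yN nxy vx vy.
    by apply: lpath1; rewrite ?xg // pxy ?pg // eq_sym xp.
  - by move=> f; rewrite !inE => /orP[]/eqP->; apply: gF.
  - rewrite !covE setU0 subUset; apply/andP; split;
      by rewrite (subset_trans _ (subsetUr _ _)) ?gU.
  - apply/subsetP=> v; rewrite !covE setU0 !inE => /andP[/orP[vg|vg] vN].
      by rewrite (gN x v xN vN vg) eqxx.
    by rewrite (gN y v yN vN vg) eqxx orbT.
have [s [ps ss sF sT sN]] := level_path lev (pN x xN) (pN y yN) axy nxy.
have pxy : p x != p y by apply: contraNneq nxy => ->.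
have xy : x != y by apply: contraNneq pxy => ->.
exists (g x :: rcons s (g y)); split.
- exists (p x); split; rewrite ?xg ?pg ?xp //.
    apply/subsetP=> v; rewrite cov_rcons !inE => /andP[vx /orP[vs|vy]].
      by rewrite (gT x v xN vx) ?(subsetP sT).
    by have [-> _] := gg x y v xN yN xy vx vy.
  apply: (lpath_rcons ps); rewrite ?pg ?xg 1?eq_sym ?xp //.
  apply/subsetP=> v; rewrite !inE => /andP[vs vy].
  by rewrite (gT y v yN vy) ?(subsetP sT).
- by rewrite /= size_rcons ss.
- move=> f; rewrite inE mem_rcons inE => /or3P[/eqP->|/eqP->|/sF//]; exact: gF.
- rewrite cov_cons cov_rcons !subUset (subset_trans sT (subsetUl _ _)).
  by rewrite !(subset_trans _ (subsetUr _ _)) ?gU.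
apply/subsetP=> v; rewrite cov_cons cov_rcons !inE.
case/andP => /or3P[vg|vs|vg] vN.
- by rewrite (gN x v xN vN vg) eqxx.
- by case/negP: (NT v vN); apply: (subsetP sT).
- by rewrite (gN y v yN vN vg) eqxx orbT.
Qed.

(** By the size of [q], the invariant [#|T| <= 2 * r * #|N|] makes the old tree account for at most
    half of [q * #|I|]; the members of [M] supply the other half, which also restores the
    invariant. *)
Lemma next_level : i < m -> 0 < #|N| -> #|T| <= 2 * r * #|N| ->
  exists T' N' a', [/\ level i.+1 T' N' a', T' \subset X,
    #|T'| <= 2 * r * #|N'| & q * #|N| <= 2 * r * B * #|N'|].
Proof.
move=> im N0 TN; have [I [IN Iadj NI]] := colour_level lev im.
have I0 : I != set0.
  apply: contraTneq N0 => I0; move: NI.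
  by rewrite I0 cards0 muln0 leqn0 -leqNgt => /eqP->.
have [M Ms qM] := maximal_spread I0 IN Iadj.
have [N' [a' [lev' cN']]] := extend_level I0 IN Ms.
have TI : 2 * #|T| <= q * #|I|.
  apply: leq_trans (leq_mul q_large (leqnn #|I|)).
  have rNI : r * #|N| <= r * (B * #|I|) by rewrite leq_mul.
  by move: TN rNI; rewrite -!mulnA; lia.
exists (T :|: \bigcup_(f in M) f), N', a'; split=> //.
- rewrite subUset TX; apply/bigcupsP=> f fM; apply: F_sub.
  by case/andP: Ms => /forallP/(_ f); rewrite fM => /and3P[].
- rewrite cN' (leq_trans (leq_card_setU _ _)) //.
  apply: (@leq_trans (#|T| + r * #|M|)); last by lia.
  rewrite leq_add2l mulnC; apply: leq_card_bigcup => f fM; apply: F_le.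
  by case/andP: Ms => /forallP/(_ f); rewrite fM => /and3P[].
rewrite cN'; apply: leq_trans (leq_mul (leqnn q) NI) _.
rewrite mulnCA -(mulnA _ B) (mulnC (2 * r)) -mulnA leq_mul // (mulnC #|M|); lia.
Qed.

End Extension.

(** From a single vertex, each of the [m] extensions multiplies the number of leaves by at least
    [q / (2 * r * B)], and all leaves stay in [X]. *)
Lemma levels_grow : X != set0 -> q ^ m <= (2 * r * B) ^ m * #|X|.
Proof.
case/set0Pn => x xX.
have [T [N [a [lev TX N0 TN qN]]]] : exists T N a, [/\ level m T N a, T \subset X,
    0 < #|N|, #|T| <= 2 * r * #|N| & q ^ m <= (2 * r * B) ^ m * #|N|].
  have q0 : 0 < q by apply: leq_trans q_large; rewrite !muln_gt0 r_gt0.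
  elim: {-2}m (leqnn m) => [|j IH] jm.
    exists [set x], [set x], (fun _ => id); rewrite cards1 sub1set; split=> //.
    - split=> // [u v|u v h]; rewrite !inE => /eqP-> /eqP-> //.
      by rewrite eqxx.
    - by rewrite muln1; lia.
  have [T [N [a [lev TX N0 TN qN]]]] := IH (ltnW jm).
  have [T' [N' [a' [lev' TX' TN' qN']]]] := next_level lev TX jm N0 TN.
  exists T', N', a'; split=> //.
    rewrite lt0n; apply: contraTneq qN' => ->.
    by rewrite muln0 -ltnNge muln_gt0 q0.
  rewrite !expnS (leq_trans (leq_mul (leqnn q) qN)) // mulnCA.
  by rewrite [X in _ <= X * _]mulnC -[X in _ <= X]mulnA leq_mul.
apply: leq_trans qN _; rewrite leq_mul // subset_leq_card //.
exact: subset_trans (level_sub lev) TX.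
Qed.

End Levels.

(** * The Ramsey bound *)

Lemma complete_copy (r t n : nat) (c : {set 'I_n} -> bool) (J : {set 'I_n}) :
  independent (color_edges r c true) J -> t <= #|J| ->
  contains_copy (color_class r c false) (complete_r_graph r t).
Proof.
move=> Ji tJ.
have lt_J (i : 'I_t) : i < #|J| by apply: leq_trans tJ.
pose f (i : 'I_t) : 'I_n := enum_val (Ordinal (lt_J i)).
have f_inj : injective f by move=> i j /enum_val_inj [] /val_inj.
exists f; split=> // e; rewrite inE => /eqP er.
have fer : #|f @: e| = r by rewrite card_imset.
rewrite !inE fer eqxx /=; apply/eqP/negP => cred.
have feH : f @: e \in color_edges r c true by rewrite !inE fer cred !eqxx.
case/negP: (Ji _ feH); apply/subsetP=> _ /imsetP[i _ ->]; exact: enum_valP.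
Qed.

Lemma cycle_family_of_lcycle (r m n : nat) (H : {set {set 'I_n}}) K f s :
  1 < m -> 1 < r -> r * (2 * m + 1) <= K -> {in H, forall e : {set 'I_n}, #|e| = r} ->
  lcycle f s -> size s = 2 * m -> {subset f :: s <= kernels H K} ->
  exists2 e : 'I_(2 * m + 1) -> {set 'I_n}, cycle_family r e & forall i, e i \in H.
Proof.
move=> m1 r1 rK Hr cfs ss fsF.
pose g (i : 'I_(2 * m + 1)) := nth set0 (f :: s) i.
have gr i : robust H K (g i).
  apply: kernel_robust; apply: fsF; apply: mem_nth => /=.
  by have := ltn_ord i; lia.
have [e eH eg] := expand_family Hr r1 rK gr.
have gI (i j : 'I_(2 * m + 1)) : i < j ->
    #|g i :&: g j| = (j == i.+1 :> nat) || ((i == 0 :> nat) && (j == 2 * m :> nat)).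
  move=> ij; have := @lcycle_nth _ f s i j; rewrite ss; apply=> //; first by lia.
  by rewrite ij; have := ltn_ord j; lia.
exists e => //; split=> [i|i|i j ij jSi iSj]; first exact: Hr.
  have iSi : i != ordS i.
    by rewrite eq_sym; apply: (@iter_ordS_neq _ i 1); lia.
  rewrite eg //; case: (ltngtP i (2 * m)) => [im|im|im].
  - have SE : ordS i = i.+1 :> nat by rewrite /= modn_small //; lia.
    by rewrite gI SE ?eqxx.
  - by have := ltn_ord i; lia.
  - have SE : ordS i = 0 :> nat by rewrite /= im -addn1 modnn.
    by rewrite setIC gI SE ?im ?eqxx ?orbT //; lia.
rewrite eg //; apply/eqP; rewrite -cards_eq0.
wlog lt_ij : i j ij jSi iSj / i < j.
  move=> W; case: (ltngtP i j) => [lt|lt|/val_inj eij].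
  - exact: W.
  - by rewrite setIC; apply: W => //; rewrite eq_sym.
  - by rewrite eij eqxx in ij.
rewrite gI //.
have jn : (j == i.+1 :> nat) = false.
  apply: contraNF jSi => /eqP jE; apply/eqP/val_inj.
  by rewrite /= -jE modn_small.
have in0 : ((i == 0 :> nat) && (j == 2 * m :> nat)) = false.
  apply: contraNF iSj => /andP[/eqP i0 /eqP jE]; apply/eqP/val_inj.
  by rewrite /= i0 jE -addn1 modnn.
by rewrite jn in0.
Qed.

(** By [levels_grow] an expanding set would have more than [q * t] vertices. Without one, greedy
    selection keeps at least [t] vertices containing no kernel, hence no red edge. *)
Lemma ramsey_prop_large (r m t q : nat) (C : r_graph r) :
  let K := r * (2 * m + 2) in
  let B := (K * K ^ (r - 2) * r).+1 in
  1 < m -> 1 < r -> is_linear_cycle (2 * m + 1) C ->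
  4 * r * B <= q -> (2 * r * B) ^ m * (q * t) < q ^ m ->
  ramsey_prop C (complete_r_graph r t) (q * t).
Proof.
move=> K B m1 r1 cyc qB qm c.
pose H := color_edges r c true.
have Hr : {in H, forall e : {set 'I_(q * t)}, #|e| = r}.
  by move=> e /color_uniform.
case: (pselect (contains_copy (color_class r c true) C)) => [|nocopy]; first by left.
right; pose F := kernels H K.
have q0 : 0 < q by apply: leq_trans qB; rewrite !muln_gt0; lia.
have K0 : 0 < K by rewrite muln_gt0; lia.
have F1 : {in F, forall f : {set 'I_(q * t)}, 1 < #|f|}.
  by move=> f; apply: card_kernel_gt1.
have no_cycle f s : lcycle f s -> size s = 2 * m -> {subset f :: s <= F} -> False.
  move=> cfs ss fsF; apply: nocopy.
  have rK : r * (2 * m + 1) <= K by rewrite leq_mul //; lia.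
  have [e ce eH] := cycle_family_of_lcycle m1 r1 rK Hr cfs ss fsF.
  have [x _] := cfs.
  by apply: (@cycle_family_copy _ _ _ (color_class r c true) C e) => //; lia.
case: (pselect (exists X, expanding F q X)) => [[X [X0 Xexp]]|noexp].
  pose FX := [set f in F | f \subset X].
  have FXF f : f \in FX -> f \in F by rewrite inE => /andP[].
  have : q ^ m <= (2 * r * B) ^ m * #|X|.
    apply: (@levels_grow _ FX X r (K ^ (r - 2)) m q) => //.
    - by move=> f; rewrite inE => /andP[].
    - by move=> f /FXF; apply: F1.
    - by move=> f /FXF/kernel_robust; apply: card_robust.
    (* The codegree bound is the kernel count above a pair, whence the exponent [r - 2]. *)
    - move=> z w zw; have := @card_kernels_above _ H r K Hr [set z; w] K0.
      rewrite cards2 zw => /(_ isT); apply: leq_trans.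
      by apply/subset_leq_card/subsetP=> f; rewrite !inE => /andP[/andP[-> _] ->].
    - move=> f s cfs ss fs; apply: (no_cycle f s) => // g /fs; exact: FXF.
    - exact: ltnW.
    - move=> I W I0 IX WX IW bl; apply: Xexp => // f fF fX; apply: bl.
      by rewrite inE fF.
  have Xn : #|X| <= q * t by rewrite -[X in _ <= X]card_ord max_card.
  have := leq_mul (leqnn ((2 * r * B) ^ m)) Xn; lia.
have F0 : {in F, forall f : {set 'I_(q * t)}, f != set0}.
  by move=> f /F1 f1; rewrite -card_gt0 ltnW.
have [|J [_ Ji Jq]] := greedy_independent (q := q) (X := setT) F0.
  by move=> Y _ Ye; apply: noexp; exists Y.
apply: (@complete_copy _ _ _ _ J) => //.
  move=> e eH; have [f fF fe] := kernel_sub_edge K Hr r1 eH.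
  by apply: contra (Ji f fF); apply: subset_trans.
by move: Jq; rewrite cardsT card_ord leq_pmul2l.
Qed.

(** * Real exponents and the final constant *)

Import Order.TTheory GRing.Theory Num.Theory.
Local Open Scope ring_scope.

Lemma exists_ramsey_number (r n : nat) (G H : r_graph r) : (0 < n)%N ->
  ramsey_prop G H n -> exists2 N, is_ramsey_number G H N & (N <= n)%N.
Proof.
move=> n0 nP; pose P k := (0 < k)%N && `[< ramsey_prop G H k >].
have exP : exists k, P k by exists n; rewrite /P n0; apply/asboolP.
case: (ex_minnP exP) => N /andP[N0 /asboolP NP] Nmin.
exists N; last by apply: Nmin; rewrite /P n0; apply/asboolP.
by split=> // k k0 kP; apply: Nmin; rewrite /P k0; apply/asboolP.
Qed.

(** Take [q] just above the real number [y] with [y ^ (m - 1) = c ^ m * t]. As [y >= 1], rounding up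
    at most doubles it; the extra factor [t] gives the exponent [1 + 1 / (m - 1) = m / (m - 1)]. *)
Lemma exists_nat_root (R : realType) (c m t : nat) :
  (1 < m)%N -> (0 < c)%N -> (0 < t)%N ->
  exists q : nat, [/\ (c <= q)%N, (c ^ m * (q * t) < q ^ m)%N &
    (q * t)%:R <= 2 * (c ^ m)%:R `^ (m%:R - 1)^-1 * t%:R `^ (m%:R / (m%:R - 1)) :> R].
Proof.
move=> m1 c0 t0.
have mE : m%:R - 1 = m.-1%:R :> R by rewrite -subn1 natrB // ltnW.
have m0 : m%:R - 1 != 0 :> R by rewrite mE pnatr_eq0; lia.
have m1_gt0 : 0 < m.-1%:R :> R by rewrite ltr0n; lia.
pose y : R := (c ^ m * t)%:R `^ (m%:R - 1)^-1.
have ct0 : (0 < c ^ m * t)%N by rewrite muln_gt0 expn_gt0 c0.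
have y1 : 1 <= y.
  rewrite /y -[X in X <= _](powRr0 (c ^ m * t)%:R) ler_powR ?ler1n // invr_ge0 mE.
  exact: ltW.
have y0 : 0 <= y := le_trans ler01 y1.
have /andP[qy yq] := truncn_itv y0; set q := (Num.truncn y).+1 in yq.
have q2y : q%:R <= 2 * y.
  by rewrite /q -natr1 mulrDl mul1r lerD.
move: q yq q2y => q yq q2y {qy}.
have yE : y ^+ m.-1 = (c ^ m * t)%:R.
  by rewrite -powR_mulrn // -mE -powRrM mulVf // powRr1.
have qm : (c ^ m * t < q ^ m.-1)%N.
  by rewrite -(ltr_nat R) -yE natrX ltrXn2r // ?nnegrE ?ler0n //; lia.
have cq : (c <= q)%N.
  rewrite leqNgt; apply/negP=> qc.
  have : (q ^ m.-1 <= c ^ m * t)%N.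
    apply: (@leq_trans (c ^ m.-1)); first by rewrite leq_exp2r ?(ltnW qc) //; lia.
    apply: (@leq_trans (c ^ m)); first by rewrite leq_pexp2l ?leq_pred.
    by rewrite leq_pmulr.
  by lia.
exists q; split=> //.
  have -> : (q ^ m = q * q ^ m.-1)%N by rewrite -expnS prednK // ltnW.
  by rewrite mulnCA ltn_pmul2l ?(leq_trans c0 cq).
rewrite natrM (le_trans (ler_wpM2r (ler0n _ _) q2y)) //.
rewrite /y natrM powRM ?ler0n // -!mulrA !ler_wpM2l ?powR_ge0 //.
have -> : m%:R / (m%:R - 1) = (m%:R - 1)^-1 + 1 :> R.
  by rewrite -[X in X / _](subrK 1) mulrDl divff // mul1r addrC.
by rewrite powRD ?powRr1 // pnatr_eq0 -lt0n t0 implybT.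
Qed.

Unset Implicit Arguments.

Theorem theorem7p13 (R : realType) (m r : nat) (hm : (2 <= m)%N) (hr : (3 <= r)%N) :
  exists2 b : R, 0 < b &
    forall C : r_graph r, is_linear_cycle (2 * m + 1)%N C ->
    forall t : nat, (0 < t)%N ->
    exists2 N : nat, is_ramsey_number C (complete_r_graph r t) N &
      N%:R <= b * t%:R `^ (m%:R / (m%:R - 1)).
Proof.
pose K := (r * (2 * m + 2))%N.
pose B := (K * K ^ (r - 2) * r).+1.
(* This [c] serves twice: [c <= q] makes [q] large enough to grow the tree, and [2 * r * B <= c]
   lets [c ^ m] dominate the loss over [m] levels. *)
pose c := (4 * r * B)%N.
have c0 : (0 < c)%N by rewrite !muln_gt0; lia.
exists (2 * (c ^ m)%:R `^ (m%:R - 1)^-1).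
  by rewrite mulr_gt0 // powR_gt0 // ltr0n expn_gt0 c0.
move=> C cyc t t0; have [q [cq qm qt]] := exists_nat_root R hm c0 t0.
have q0 : (0 < q)%N := leq_trans c0 cq.
have qtP : ramsey_prop C (complete_r_graph r t) (q * t).
  apply: (ramsey_prop_large hm (ltnW hr) cyc cq).
  apply: leq_ltn_trans qm; rewrite leq_mul // leq_exp2r; last by lia.
  by rewrite !leq_mul.
have [|N RN Nqt] := exists_ramsey_number _ qtP; first by rewrite muln_gt0 q0.
by exists N => //; apply: le_trans qt; rewrite ler_nat.
Qed.
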